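(* Let $y_1,\dots,y_n\in\mathbb{R}^d$, $p\in(0,1)$, $\tau,\tau_0>0$, and consider the CAVI algorithm for the two-component Bayesian Gaussian mixture posterior on $(z,\beta)\in\{0,1\}^n\times\mathbb{R}^d$, $$\pi(z,\beta)\propto\prod_{i=1}^n\left\{p\,\mathbf 1_{\{z_i=1\}}\mathcal{N}(y_i;\beta,\tau^{-1}I_d)+(1-p)\,\mathbf 1_{\{z_i=0\}}\mathcal{N}(y_i;-\beta,\tau^{-1}I_d)\right\}\mathcal{N}(\beta;0,\tau_0^{-1}I_d).$$ Let $\mu_\star^2$ be a fixed point of the $\beta$-update, $\mu_\star^2=\mu_\star^2[\mu_\star^1[\mu_\star^2]]$, let $\varepsilon>0$, and suppose the starting distribution $\mu_0^2\in\mathcal{P}_2(\mathbb{R}^d)$ satisfies $\mathbb{W}_2(\mu_0^2,\mu_\star^2)<\varepsilon$. If $$r_\varepsilon:=\frac{\tau^2}{\tau_0+\tau n}\sup_{|x-\mathbb{E}_{\mu_\star^2}[\beta]|\le\varepsilon}\lambda_{\max}\left(\sum_{i=1}^n\mathrm{sech}^2\left(\tfrac12\log\tfrac{p}{1-p}+\tau y_i^\top x\right)y_iy_i^\top\right)<1,$$ then $(\mu_k^2)_{k\ge0}$ converges exponentially fast to $\mu_\star^2$ in Wasserstein-$2$ distance with rate $r_\varepsilon$, i.e. $\mathbb{W}_2(\mu_{k+1}^2,\mu_\star^2)\le r_\varepsilon\,\mathbb{W}_2(\mu_k^2,\mu_\star^2)$ for all $k\ge0$.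
   Context: $\mathcal{N}(\cdot\,;m,\Sigma)$ is the Gaussian density; $\lambda_{\max}$ the largest eigenvalue; $\mathbb{W}_2$ the Wasserstein-2 distance for the Euclidean metric on $\mathbb{R}^d$; $\mathcal{P}_2(\mathbb{R}^d)$ the absolutely continuous probability measures with finite second moment. Two-block CAVI approximates $\pi$ by $\mu^1(dz)\otimes\mu^2(d\beta)$, minimising $\mathrm{KL}(\mu^1\otimes\mu^2\|\pi)$ alternately: $\mu_{k+1}^1=\mu_\star^1[\mu_k^2]$, $\mu_{k+1}^2=\mu_\star^2[\mu_{k+1}^1]$, where $$\mu_\star^1[\mu^2]=\bigotimes_{i=1}^n\mathrm{Ber}(r_{i,\mu^2}),\quad \mathrm{logit}(r_{i,\mu^2})=\log\tfrac{p}{1-p}+2\tau y_i^\top\mathbb{E}_{\mu^2}[\beta],$$ $$\mu_\star^2[\mu^1]=\mathcal{N}\left(m_{\mu^1},(\tau_0+n\tau)^{-1}I_d\right),\quad m_{\mu^1}=(\tau_0+n\tau)^{-1}\tau\sum_{i=1}^n\mathbb{E}_{\mu^1}[2Z_i-1]\,y_i.$$ *)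

(* Defs.v *)
From HB Require Import structures.
From mathcomp Require Import all_boot all_order all_algebra.
From mathcomp Require Import all_classical all_reals all_analysis.
From mathcomp Require Import measurable_realfun. 
From mathcomp Require Import ring lra.

Set Implicit Arguments.
Unset Strict Implicit.
Unset Printing Implicit Defensive.

Import Order.TTheory GRing.Theory Num.Theory.
Import numFieldNormedType.Exports.

Local Open Scope classical_set_scope.
Local Open Scope ring_scope.

Section cons_measure.
Context d (T : measurableType d) (R : realType) (n : nat).
Variables (m1 : {sigma_finite_measure set T -> \bar R})
          (m2 : {sigma_finite_measure set n.-tuple T -> \bar R}).

Let cons_pair (x : T * n.-tuple T) : n.+1.-tuple T := [tuple of x.1 :: x.2].

Lemma measurable_cons_pair : measurable_fun [set: T * n.-tuple T] cons_pair.
Proof. exact: measurable_cons. Qed.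

Definition cons_measure : set (n.+1.-tuple T) -> \bar R :=
  pushforward (m1 \x m2)%E (fun x : T * n.-tuple T => [tuple of x.1 :: x.2]).

Let mpre A : measurable A -> measurable (cons_pair @^-1` A).
Proof. by move=> mA; rewrite -[X in measurable X]setTI; exact: measurable_cons_pair. Qed.

Let cons_measure0 : cons_measure set0 = 0%E.
Proof. by rewrite /cons_measure /pushforward preimage_set0 measure0. Qed.

Let cons_measure_ge0 A : (0 <= cons_measure A)%E.
Proof. exact: (measure_ge0 (m1 \x m2)%E). Qed.

Let cons_measure_sigma_additive : semi_sigma_additive cons_measure.
Proof.
move=> F mF tF mUF; rewrite /cons_measure /pushforward preimage_bigcup.
apply: measure_semi_sigma_additive.
- by move=> k; exact: mpre.
- apply/trivIsetP => /= i j _ _ ij; rewrite -preimage_setI.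
  by move/trivIsetP : tF => /(_ _ _ _ _ ij) ->//; rewrite preimage_set0.
- by rewrite -preimage_bigcup; exact: mpre.
Qed.

HB.instance Definition _ := isMeasure.Build _ _ _ cons_measure
  cons_measure0 cons_measure_ge0 cons_measure_sigma_additive.

Let cons_measure_sigma_finite : sigma_finite setT cons_measure.
Proof.
have /sigma_finiteP[F [TF ndF Foo]] := sigma_finiteT m1.
have /sigma_finiteP[G [TG ndG Goo]] := sigma_finiteT m2.
pose uncons (t : n.+1.-tuple T) := (thead t, [tuple of behead t]).
have muncons : measurable_fun [set: n.+1.-tuple T] uncons.
  by apply/measurable_fun_pairP; split;
    [exact: measurable_tnth|exact: measurable_behead].
exists (fun k => uncons @^-1` (F k `*` G k)).
  rewrite -preimage_bigcup [X in _ @^-1` X](_ : _ = setT) ?preimage_setT//.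
  apply/seteqP; split => // -[x t] _.
  have [i _ Fix] : (\bigcup_k F k) x by rewrite -TF.
  have [j _ Gjt] : (\bigcup_k G k) t by rewrite -TG.
  exists (maxn i j) => //; split.
    by move: x Fix; exact/subsetPset/ndF/leq_maxl.
  by move: t Gjt; exact/subsetPset/ndG/leq_maxr.
move=> k; have [mFk Fkoo] := Foo k; have [mGk Gkoo] := Goo k; split.
  by rewrite -[X in measurable X]setTI; apply: muncons => //; exact: measurableX.
rewrite /cons_measure /pushforward.
rewrite [X in (m1 \x m2)%E X](_ : _ = F k `*` G k).
  by rewrite product_measure1E// lte_mul_pinfty// ge0_fin_numE.
by apply/seteqP; split => -[x t] /=; rewrite /uncons theadE /=;
  rewrite (_ : [tuple of behead (x :: t)] = t)//; exact/val_inj.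
Qed.

HB.instance Definition _ := Measure_isSigmaFinite.Build _ _ _ cons_measure
  cons_measure_sigma_finite.

End cons_measure.

Fixpoint tuple_prod d (T : measurableType d) (R : realType) (n : nat) :
    ('I_n -> {sigma_finite_measure set T -> \bar R}) ->
    {sigma_finite_measure set n.-tuple T -> \bar R} :=
  match n with
  | 0 => fun=> \d_[tuple of [::]]
  | n'.+1 => fun m =>
      cons_measure (m ord0) (tuple_prod (fun i => m (lift ord0 i)))
  end.

Lemma ge0_integral_tuple_prod d (T : measurableType d) (R : realType) (n : nat)
    (m : 'I_n -> {sigma_finite_measure set T -> \bar R})
    (f : 'I_n -> T -> R) :
    (forall i, measurable_fun setT (f i)) -> (forall i x, 0 <= f i x) ->
  (\int[tuple_prod m]_t (\prod_(i < n) f i (tnth t i))%:E =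
   \prod_(i < n) \int[m i]_x (f i x)%:E)%E.
Proof.
elim: n => [|n IHn] in m f * => mf f0.
  rewrite big_ord0 (eq_integral (cst 1%E)); last by move=> t _; rewrite big_ord0.
  by rewrite integral_cst//= diracT mul1e.
have mprod k (g : 'I_k -> T -> R) : (forall i, measurable_fun setT (g i)) ->
    measurable_fun setT (EFin \o fun t : k.-tuple T => \prod_(i < k) g i (tnth t i)).
  move=> mg; apply/measurable_EFinP; apply: measurable_prod => i _.
  by apply: measurableT_comp (mg i) _; exact: measurable_tnth.
rewrite ge0_integral_pushforward//=; last 3 first.
- exact: measurable_cons_pair.
- exact: mprod.
- by move=> t _; rewrite lee_fin prodr_ge0.
rewrite preimage_setT fubini_tonelli1//=; last 2 first.
- exact: measurableT_comp (mprod _ _ mf) (@measurable_cons_pair _ _ _).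
- by move=> x; rewrite lee_fin prodr_ge0.
pose c := (\prod_(i < n) \int[m (lift ord0 i)]_x (f (lift ord0 i) x)%:E)%E.
have c0 : (0 <= c)%E.
  by apply: prode_ge0 => i _; apply: integral_ge0 => x _; rewrite lee_fin.
transitivity (\int[m ord0]_x ((f ord0 x)%:E * c))%E; last first.
  rewrite big_ord_recl ge0_integralZr//; first exact/measurable_EFinP.
  by move=> x _; rewrite lee_fin.
apply: eq_integral => x _; rewrite /fubini_F /=.
rewrite /c -IHn// -ge0_integralZl_EFin//; last 2 first.
- by move=> t _; rewrite lee_fin prodr_ge0.
- by apply: (mprod _ (fun i => f (lift ord0 i))) => i.
apply: eq_integral => t _; rewrite -EFinM big_ord_recl.
by congr (_ * _)%:E; apply: eq_bigr => i _; rewrite tnthS.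
Qed.

Lemma tuple_prod_setT d (T : measurableType d) (R : realType) (n : nat)
    (P : 'I_n -> probability T R) :
  tuple_prod P [set: n.-tuple T] = 1%E.
Proof.
have := @ge0_integral_tuple_prod _ T R n P (fun _ => cst 1).
move=> /(_ (fun=> measurable_cst _) (fun _ _ => ler01)).
rewrite [in RHS]big1; last first.
  move=> i _; rewrite (eq_integral (cst 1%E))//.
  by rewrite integral_cst//= mul1e probability_setT.
move=> <-; rewrite (eq_integral (cst 1%E)) ?integral_cst ?mul1e//.
by move=> t _; rewrite big1.
Qed.

Definition measure_row_display : measure_display -> measure_display.
Proof. exact. Qed.

Section measurable_row.
Context {d} {T : sigmaRingType d}.
Variable n : nat.

Let coors : 'I_n -> 'rV[T]_n -> T := fun i x => x ord0 i.

Let row_set0 : g_sigma_preimage coors set0.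
Proof. exact: sigma_algebra0. Qed.

Let row_setC A : g_sigma_preimage coors A -> g_sigma_preimage coors (~` A).
Proof. exact: sigma_algebraC. Qed.

Let row_bigcup (F : _^nat) : (forall i, g_sigma_preimage coors (F i)) ->
  g_sigma_preimage coors (\bigcup_i (F i)).
Proof. exact: sigma_algebra_bigcup. Qed.

(* The product sigma-algebra; for T = R this is the Borel sigma-algebra. *)
HB.instance Definition _ := @isMeasurable.Build (measure_row_display d)
  'rV[T]_n (g_sigma_preimage coors) row_set0 row_setC row_bigcup.

End measurable_row.

Lemma measurable_coord d (T : sigmaRingType d) n (i : 'I_n) :
  measurable_fun [set: 'rV[T]_n] (fun x => x ord0 i).
Proof.
move=> _ Y mY; rewrite setTI; apply: sub_sigma_algebra => /=.
rewrite -bigcup_seq/=; exists i => /=; first by rewrite mem_index_enum.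
by exists Y => //; rewrite setTI.
Qed.

Definition row_of_tuple (T : Type) n (t : n.-tuple T) : 'rV[T]_n :=
  \row_i tnth t i.

Lemma measurable_row_of_tuple d (T : measurableType d) n :
  measurable_fun [set: n.-tuple T] (@row_of_tuple T n).
Proof.
move=> _ Y mY.
have := g_sigma_preimage_comp (fun i (x : 'rV[T]_n) => x ord0 i)
  (@row_of_tuple T n).
rewrite (_ : (fun i => _ \o _) = (fun i x => tnth x i)); last first.
  by apply/funext => i; apply/funext => t /=; rewrite mxE.
by move=> e; rewrite /measurable/= e; exists Y.
Qed.

Section euclidean.
Context {R : realType} {d : nat}.
Implicit Types x y : 'rV[R]_d.

Definition dotv x y : R := \sum_i x ord0 i * y ord0 i.

(* The library norm on 'rV[R]_d is the sup norm. *)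
Definition enorm x : R := Num.sqrt (dotv x x).

End euclidean.

Section lebesgue_rV.
Context (R : realType) (d : nat).

Definition lebesgue_rV : set 'rV[R]_d -> \bar R :=
  pushforward (tuple_prod (fun=> @lebesgue_measure R)) (@row_of_tuple R d).

Let lebesgue_rV0 : lebesgue_rV set0 = 0%E.
Proof. by rewrite /lebesgue_rV /pushforward preimage_set0 measure0. Qed.

Let lebesgue_rV_ge0 A : (0 <= lebesgue_rV A)%E.
Proof. by rewrite /lebesgue_rV /pushforward measure_ge0. Qed.

Let mpre A : measurable A -> measurable (@row_of_tuple R d @^-1` A).
Proof.
by move=> mA; rewrite -[X in measurable X]setTI; exact: measurable_row_of_tuple.
Qed.

Let lebesgue_rV_sigma_additive : semi_sigma_additive lebesgue_rV.
Proof.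
move=> F mF tF mUF; rewrite /lebesgue_rV /pushforward preimage_bigcup.
apply: measure_semi_sigma_additive.
- by move=> k; exact: mpre.
- apply/trivIsetP => /= i j _ _ ij; rewrite -preimage_setI.
  by move/trivIsetP : tF => /(_ _ _ _ _ ij) ->//; rewrite preimage_set0.
- by rewrite -preimage_bigcup; exact: mpre.
Qed.

HB.instance Definition _ := isMeasure.Build _ _ _ lebesgue_rV
  lebesgue_rV0 lebesgue_rV_ge0 lebesgue_rV_sigma_additive.

End lebesgue_rV.
Arguments lebesgue_rV {R} d _.

Section gaussian.
Context {R : realType} {d : nat}.
Implicit Types (m x : 'rV[R]_d) (v : R).

(* Density of N(m, v I_d). *)
Definition gauss_pdf m v x : R :=
  (Num.sqrt (2 * pi * v))^-1 ^+ d * expR (- enorm (x - m) ^+ 2 / (2 * v)).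

(* N(m, v I_d); the degenerate case v <= 0 is a Dirac mass, so that this is a
   probability measure for every v. *)
Definition gaussian m v : set 'rV[R]_d -> \bar R := fun A =>
  if 0 < v then (\int[lebesgue_rV d]_(x in A) (gauss_pdf m v x)%:E)%E
  else \d_m A.

Lemma dotv_ge0 x : 0 <= dotv x x.
Proof. by apply: sumr_ge0 => i _; rewrite -expr2 sqr_ge0. Qed.

Lemma enorm_sqr x : enorm x ^+ 2 = dotv x x.
Proof. by rewrite sqr_sqrtr// dotv_ge0. Qed.

Lemma gauss_pdf_ge0 m v x : 0 <= gauss_pdf m v x.
Proof. by rewrite mulr_ge0 ?expR_ge0// exprn_ge0// invr_ge0 sqrtr_ge0. Qed.

Lemma gauss_pdf_prod m v x : 0 < v ->
  gauss_pdf m v x =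
  \prod_i normal_pdf (m ord0 i) (Num.sqrt v) (x ord0 i).
Proof.
move=> v0; rewrite /gauss_pdf enorm_sqr /dotv.
under eq_bigr do rewrite normal_pdfE ?gt_eqF ?sqrtr_gt0// /normal_peak
  /normal_fun sqr_sqrtr ?ltW//.
rewrite big_split/= prodr_const card_ord; congr *%R.
  by congr ((Num.sqrt _)^-1 ^+ _); rewrite -mulr_natl; ring.
rewrite -expR_sum mulNr mulr_suml -sumrN; congr expR; apply: eq_bigr => i _.
by rewrite !mxE -mulNr mulr_natl expr2.
Qed.

Lemma measurable_gauss_pdf m v : measurable_fun setT (gauss_pdf m v).
Proof.
rewrite /gauss_pdf; apply: measurable_funM => //.
apply: measurableT_comp => //; apply: measurable_funM => //.
apply: measurableT_comp => //.
under eq_fun do rewrite enorm_sqr /dotv.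
apply: measurable_sum => i.
under eq_fun do rewrite !mxE.
have mi : measurable_fun setT (fun x : 'rV[R]_d => x ord0 i - m ord0 i).
  by apply: measurable_funB => //; exact: measurable_coord.
exact: measurable_funM.
Qed.

Lemma integral_gauss_pdf m v : 0 < v ->
  (\int[lebesgue_rV d]_x (gauss_pdf m v x)%:E = 1)%E.
Proof.
move=> v0; rewrite ge0_integral_pushforward//=; last 3 first.
- exact: measurable_row_of_tuple.
- by apply/measurable_EFinP; exact: measurable_gauss_pdf.
- by move=> x _; rewrite lee_fin gauss_pdf_ge0.
rewrite preimage_setT.
under eq_integral.
  move=> t _; rewrite gauss_pdf_prod//.
  under eq_bigr do rewrite mxE.
  over.
rewrite (ge0_integral_tuple_prod (fun=> @lebesgue_measure R)
  (f := fun i => normal_pdf (m ord0 i) (Num.sqrt v))).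
- by rewrite big1// => i _; exact: integral_normal_pdf.
- by move=> i; exact: measurable_normal_pdf.
- by move=> i x; exact: normal_pdf_ge0.
Qed.

Context (m : 'rV[R]_d) (v : R).

Let gaussian0 : gaussian m v set0 = 0%E.
Proof. by rewrite /gaussian; case: ifP => _; rewrite ?integral_set0 ?measure0. Qed.

Let gaussian_ge0 A : (0 <= gaussian m v A)%E.
Proof.
rewrite /gaussian; case: ifP => _; last exact: measure_ge0.
by apply: integral_ge0 => x _; rewrite lee_fin gauss_pdf_ge0.
Qed.

Let gaussian_sigma_additive : semi_sigma_additive (gaussian m v).
Proof.
have [v0|v0] := boolP (0 < v); last first.
  rewrite (_ : gaussian m v = \d_m); first exact: measure_semi_sigma_additive.
  by apply/funext => A; rewrite /gaussian (negbTE v0).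
rewrite (_ : gaussian m v =
    fun A => (\int[lebesgue_rV d]_(x in A) (gauss_pdf m v x)%:E)%E); last first.
  by apply/funext => A; rewrite /gaussian v0.
have int : (lebesgue_rV d).-integrable setT (EFin \o gauss_pdf m v).
  apply/integrableP; split.
    by apply/measurable_EFinP; exact: measurable_gauss_pdf.
  rewrite (eq_integral (EFin \o gauss_pdf m v)) ?integral_gauss_pdf ?ltry//.
  by move=> x _; rewrite /= ger0_norm// gauss_pdf_ge0.
move=> /= A mA tA mUA; rewrite integral_bigcup//=; last first.
  exact: integrableS int.
apply: is_cvg_ereal_nneg_natsum_cond => k _ _.
by apply: integral_ge0 => x _; rewrite lee_fin gauss_pdf_ge0.
Qed.

HB.instance Definition _ := isMeasure.Build _ _ _ (gaussian m v)
  gaussian0 gaussian_ge0 gaussian_sigma_additive.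

Let gaussian_setT : gaussian m v setT = 1%E.
Proof.
rewrite /gaussian; case: ifP => [v0|_]; first exact: integral_gauss_pdf.
exact: probability_setT.
Qed.

HB.instance Definition _ :=
  @Measure_isProbability.Build _ _ R (gaussian m v) gaussian_setT.

End gaussian.

Section bernoulli_tuple.
Context {R : realType} {n : nat} (r : 'I_n -> R).

Definition bernoulli_tuple : set (n.-tuple bool) -> \bar R :=
  tuple_prod (fun i => bernoulli_prob (r i)).

HB.instance Definition _ := Measure.on bernoulli_tuple.

Let bernoulli_tuple_setT : bernoulli_tuple setT = 1%E.
Proof. exact: tuple_prod_setT. Qed.

HB.instance Definition _ :=
  @Measure_isProbability.Build _ _ R bernoulli_tuple bernoulli_tuple_setT.

End bernoulli_tuple.

Section wasserstein.
Context {R : realType} {d : nat}.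
Implicit Types mu nu : probability 'rV[R]_d R.

Definition mean mu : 'rV[R]_d :=
  \row_j fine ('E_mu[fun x : 'rV[R]_d => x ord0 j])%E.

Definition P2 mu : Prop :=
  mu `<< lebesgue_rV d /\ (\int[mu]_x (enorm x ^+ 2)%:E < +oo)%E.

Definition is_coupling mu nu (g : probability ('rV[R]_d * 'rV[R]_d)%type R) :=
  forall A, measurable A -> g (A `*` setT) = mu A /\ g (setT `*` A) = nu A.

Definition W2 mu nu : \bar R :=
  sqrte (ereal_inf [set (\int[g]_z (enorm (z.1 - z.2) ^+ 2)%:E)%E
                   | g in is_coupling mu nu]).

End wasserstein.

Section real_functions.
Context {R : realType}.

Definition logit (q : R) : R := ln (q / (1 - q)).

Definition expit (t : R) : R := (1 + expR (- t))^-1.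

Lemma expit_itv t : 0 < expit t < 1.
Proof.
have e0 := expR_gt0 (- t).
by rewrite /expit invr_gt0 invf_lt1 ?ltrDl ?addr_gt0// e0.
Qed.

Lemma expitK : cancel expit logit.
Proof.
move=> t; rewrite /logit /expit.
have e0 : 0 < expR (- t) := expR_gt0 _.
have e1 : 1 + expR (- t) != 0 by rewrite gt_eqF// addr_gt0.
rewrite (_ : _ / _ = (expR (- t))^-1); first by rewrite -expRN opprK expRK.
by field; rewrite e1 gt_eqF//= addrAC subrr add0r gt_eqF.
Qed.

Definition sech (t : R) : R := 2 / (expR t + expR (- t)).

(* The largest eigenvalue when A is symmetric of positive size. *)
Definition lambda_max d (A : 'M[R]_d) : R := sup [set a | eigenvalue A a].

End real_functions.

Section cavi.
Context {R : realType} {d n : nat}.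
Variables (y : 'I_n -> 'rV[R]_d) (p tau tau0 : R).

(* Unnormalised density of the posterior with respect to the product of the
   counting measure on {0,1}^n and the Lebesgue measure on R^d. *)
Definition gm_joint (z : n.-tuple bool) (b : 'rV[R]_d) : R :=
  (\prod_i if tnth z i then p * gauss_pdf b tau^-1 (y i)
           else (1 - p) * gauss_pdf (- b) tau^-1 (y i))
  * gauss_pdf 0 tau0^-1 b.

Definition z_update (mu2 : probability 'rV[R]_d R) :
    probability (n.-tuple bool) R :=
  bernoulli_tuple
    (fun i => expit (ln (p / (1 - p)) + 2 * tau * dotv (y i) (mean mu2))).

Definition beta_mean (mu1 : probability (n.-tuple bool) R) : 'rV[R]_d :=
  ((tau0 + n%:R * tau)^-1 * tau) *:
    \sum_i fine ('E_mu1[(fun z => 2 * (tnth z i)%:R - 1)%R])%E *: y i.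

Definition beta_update (mu1 : probability (n.-tuple bool) R) :
    probability 'rV[R]_d R :=
  gaussian (beta_mean mu1) (tau0 + n%:R * tau)^-1.

Definition cavi_beta (mu0 : probability 'rV[R]_d R) (k : nat) :
    probability 'rV[R]_d R :=
  iter k (fun mu2 => beta_update (z_update mu2)) mu0.

Definition cavi_rate (c : 'rV[R]_d) (eps : R) : R :=
  tau ^+ 2 / (tau0 + tau * n%:R) *
  sup [set lambda_max
         (\sum_i sech (2^-1 * ln (p / (1 - p)) + tau * dotv (y i) x) ^+ 2
                 *: ((y i)^T *m y i))
      | x in [set x : 'rV[R]_d | enorm (x - c) <= eps]].

End cavi.

(* Main.v *)
From HB Require Import structures.
Require Import Defs.
From mathcomp Require Import all_boot all_order all_algebra.
From mathcomp Require Import all_classical all_reals all_analysis.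
From mathcomp Require Import measurable_realfun.
From mathcomp Require Import ring lra.

Set Implicit Arguments.
Unset Strict Implicit.
Unset Printing Implicit Defensive.

Import Order.TTheory GRing.Theory Num.Theory.
Import numFieldNormedType.Exports.
Local Open Scope classical_set_scope.
Local Open Scope ring_scope.

(* A sweep of the algorithm sends a law with mean x to the Gaussian with mean
   F(x) and fixed covariance, where F is [mean_map].  The derivative of F at x is
   tau^2 / (tau0 + n tau) times the sech^2-weighted Gram matrix, which is
   symmetric and positive semidefinite, so that by the mean value theorem F
   contracts distances to the fixed point by the factor [cavi_rate] on the ball
   of radius eps.  The translation coupling bounds W2 between two Gaussians with
   equal covariance by the distance of their means, and Jensen's inequality
   bounds the distance of the means of any two laws by their W2; hence
   W2(mu_(k+1), mu_star) <= |F(x_k) - F(x_star)| <= r |x_k - x_star|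
   <= r W2(mu_k, mu_star), and the iterates never leave the ball. *)

(** * Quadratic forms and the largest eigenvalue *)

(** The minimum over t of the quadratic is attained at -b/c and equals (a c - b^2)/c. The degenerate
    case c = 0 is included because the forms it is applied to are only semidefinite. *)
Lemma discriminant_le (R : realFieldType) (a b c : R) : 0 <= c ->
  (forall t, 0 <= a + 2 * t * b + t ^+ 2 * c) -> b ^+ 2 <= a * c.
Proof.
move=> c_ge0 h; have [c0|c0] := eqVneq c 0.
  rewrite c0 mulr0; have [->|b0] := eqVneq b 0; first by rewrite expr0n.
  (* For c = 0 the expression is affine in t, and at this t it equals -1. *)
  have := h (- (a + 1) / (2 * b)).
  by rewrite c0 (_ : _ + _ + _ = -1) ?oppr_ge0 ?ler10//; field.
have := h (- b / c); rewrite (_ : a + _ + _ = (a * c - b ^+ 2) / c); last by field.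
by rewrite pmulr_lge0 ?subr_ge0// invr_gt0 lt_def c0.
Qed.

Section quadratic_forms.
Context {R : realType} {d : nat}.
Implicit Types (x z : 'rV[R]_d) (A : 'M[R]_d).

Lemma dotvE x z : dotv x z = (x *m z^T) ord0 ord0.
Proof. by rewrite mxE; apply: eq_bigr => i _; rewrite mxE. Qed.

Lemma dotvC x z : dotv x z = dotv z x.
Proof. by apply: eq_bigr => i _; rewrite mulrC. Qed.

Lemma dotvDl x x' z : dotv (x + x') z = dotv x z + dotv x' z.
Proof. by rewrite !dotvE mulmxDl mxE. Qed.

Lemma dotvZl a x z : dotv (a *: x) z = a * dotv x z.
Proof. by rewrite !dotvE -scalemxAl mxE. Qed.

Lemma dotvNl x z : dotv (- x) z = - dotv x z.
Proof. by rewrite -scaleN1r dotvZl mulN1r. Qed.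

Lemma dotvBl x x' z : dotv (x - x') z = dotv x z - dotv x' z.
Proof. by rewrite dotvDl dotvNl. Qed.

Lemma dotvDr x z z' : dotv x (z + z') = dotv x z + dotv x z'.
Proof. by rewrite dotvC dotvDl !(dotvC x). Qed.

Lemma dotvZr a x z : dotv x (a *: z) = a * dotv x z.
Proof. by rewrite dotvC dotvZl dotvC. Qed.

Lemma dotvBr x z z' : dotv x (z - z') = dotv x z - dotv x z'.
Proof. by rewrite dotvC dotvBl !(dotvC x). Qed.

Lemma dotv0l z : dotv 0 z = 0.
Proof. by rewrite dotvE mul0mx mxE. Qed.

Lemma dotv_suml I (r : seq I) (F : I -> 'rV[R]_d) z :
  dotv (\sum_(i <- r) F i) z = \sum_(i <- r) dotv (F i) z.
Proof.
by elim/big_rec2 : _ => [|i a v _ <-]; rewrite ?dotv0l ?dotvDl.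
Qed.

Lemma dotv_eq0 x : (dotv x x == 0) = (x == 0).
Proof.
apply/idP/eqP => [|->]; last by rewrite dotv0l.
rewrite psumr_eq0; last by move=> i _; rewrite -expr2 sqr_ge0.
move/allP => h; apply/rowP => i; rewrite mxE; apply/eqP.
by have := h i (mem_index_enum i); rewrite /= mulf_eq0 orbb.
Qed.

Lemma enorm_ge0 x : 0 <= enorm x.
Proof. exact: sqrtr_ge0. Qed.

Lemma dotv_mulmx_sym A x z : A^T = A -> dotv (x *m A) z = dotv x (z *m A).
Proof. by move=> sA; rewrite !dotvE trmx_mul sA mulmxA. Qed.

(** Positivity of the form at x + t z for every t gives a nonnegative quadratic in t; symmetry of A
    merges its two cross terms. *)
Lemma psd_cauchy_schwarz A x z : A^T = A -> (forall u, 0 <= dotv (u *m A) u) ->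
  dotv (x *m A) z ^+ 2 <= dotv (x *m A) x * dotv (z *m A) z.
Proof.
move=> sA A0; apply: discriminant_le => // t.
rewrite (_ : _ + _ = dotv ((x + t *: z) *m A) (x + t *: z))//.
rewrite mulmxDl -scalemxAl !dotvDl !dotvDr !dotvZl !dotvZr.
by rewrite (dotv_mulmx_sym z x sA) (dotvC z); ring.
Qed.

Lemma dotv_cauchy_schwarz x z : dotv x z ^+ 2 <= dotv x x * dotv z z.
Proof.
have := @psd_cauchy_schwarz 1%:M x z; rewrite !mulmx1; apply.
  exact: trmx1.
by move=> u; rewrite mulmx1 dotv_ge0.
Qed.

(** The constant is the squared Frobenius norm: Cauchy-Schwarz is applied to x and each column of
    A. *)
Lemma mulmx_bounded A :
  exists2 C, 0 <= C & forall x, dotv (x *m A) (x *m A) <= C * dotv x x.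
Proof.
exists (\sum_j dotv (col j A)^T (col j A)^T).
  by apply: sumr_ge0 => j _; exact: dotv_ge0.
move=> x; rewrite mulr_suml; apply: ler_sum => j _.
rewrite -expr2 mulrC (_ : (x *m A) ord0 j = dotv x (col j A)^T).
  exact: dotv_cauchy_schwarz.
by rewrite mxE; apply: eq_bigr => i _; rewrite !mxE.
Qed.

(** Expanding |xA - x|^2 >= 0 bounds 2 xA.x by |xA|^2 + |x|^2. *)
Lemma quadratic_form_bounded A :
  exists2 C, 0 <= C & forall x, dotv (x *m A) x <= C * dotv x x.
Proof.
have [C C0 AC] := mulmx_bounded A; exists (C + 1); first by rewrite addr_ge0.
move=> x; have := dotv_ge0 (x *m A - x); have := AC x; have := dotv_ge0 x.
rewrite dotvBl !dotvBr (dotvC x); have := dotv_ge0 (x *m A); nra.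
Qed.

Lemma eigenvalue_le A K a : (forall x, dotv (x *m A) x <= K * dotv x x) ->
  eigenvalue A a -> a <= K.
Proof.
move=> AK /eigenvalueP[v vA v0]; have := AK v.
by rewrite vA dotvZl ler_pM2r// lt_def dotv_eq0 v0 dotv_ge0.
Qed.

(** With w = xA, the semidefinite Cauchy-Schwarz inequality gives |w|^4 <= (xA.x)(wA.w) <= C |w|^2
    (xA.x), hence |w|^2 <= C (xA.x). Boundedness of the inverse then gives |x|^2 <= D |w|^2. *)
Lemma psd_unit_coercive A : A^T = A -> (forall u, 0 <= dotv (u *m A) u) ->
  A \in unitmx -> exists2 C, 0 <= C & forall x, dotv x x <= C * dotv (x *m A) x.
Proof.
move=> sA A0 uA.
have [C C0 AC] := quadratic_form_bounded A.
have [D D0 AD] := mulmx_bounded (invmx A).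
exists (D * C) => [|x]; first by rewrite mulr_ge0.
set w := x *m A; have wq := AC w.
have ww : dotv w w <= C * dotv w x.
  have := psd_cauchy_schwarz x w sA A0; rewrite -/w.
  have := A0 x; rewrite -/w; have := dotv_ge0 w.
  rewrite le_eqVlt => /predU1P[<- q0 _|w0 q0 qw]; first by rewrite mulr_ge0.
  rewrite -(ler_pM2r w0) -expr2 (le_trans qw)//.
  by rewrite mulrAC mulrC ler_wpM2r.
have := AD w; rewrite mulmxK// => /le_trans; apply.
by rewrite -mulrA ler_wpM2l.
Qed.

End quadratic_forms.

(* With M the supremum of the Rayleigh quotient, M - A is positive semidefinite
   but not coercive, hence singular: M is an eigenvalue. *)
Lemma rayleigh_le_lambda_max (R : realType) (d : nat) (A : 'M[R]_d) x :
  A^T = A -> dotv (x *m A) x <= lambda_max A * dotv x x.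
Proof.
case: d A x => [|d] A x sA; first by rewrite /dotv !big_ord0 mulr0.
pose S : set R := [set dotv (z *m A) z | z in [set z : 'rV[R]_d.+1 | dotv z z = 1]].
have [C C0 AC] := quadratic_form_bounded A.
have S_sup : has_sup S; [split|].
- exists (dotv (delta_mx 0 0 *m A) (delta_mx 0 0)), (delta_mx 0 0) => //=.
  rewrite /dotv (bigD1 ord0)//= big1 ?addr0 => [|i /negbTE i0].
    by rewrite !mxE !eqxx mulr1.
  by rewrite !mxE i0 andbF mulr0.
- by exists C => _ [z /= z1 <-]; rewrite (le_trans (AC z))// z1 mulr1.
set M := sup S.
have AM z : dotv (z *m A) z <= M * dotv z z.
  have [->|z0] := eqVneq z 0; first by rewrite mul0mx dotv0l mulr0.
  have zz : 0 < dotv z z by rewrite lt_def dotv_eq0 z0 dotv_ge0.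
  have s2 : Num.sqrt (dotv z z) ^+ 2 = dotv z z by rewrite sqr_sqrtr// dotv_ge0.
  have s0 : 0 < Num.sqrt (dotv z z) by rewrite sqrtr_gt0.
  set s := Num.sqrt _ in s2 s0.
  have : S (dotv (z *m A) z / dotv z z).
    exists (s^-1 *: z) => /=.
      by rewrite dotvZl dotvZr -s2; field; rewrite gt_eqF.
    by rewrite -scalemxAl dotvZl dotvZr -s2; field; rewrite gt_eqF.
  move=> /(ub_le_sup (proj2 S_sup)); rewrite -/M ler_pdivrMr//.
have eM : eigenvalue A M.
  apply: contraT; rewrite /eigenvalue /= negbK => /eqP AM0; exfalso.
  pose B := M%:M - A.
  have qB z : dotv (z *m B) z = M * dotv z z - dotv (z *m A) z.
    by rewrite mulmxBr dotvBl mul_mx_scalar dotvZl.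
  have uB : B \in unitmx.
    rewrite -row_free_unit -kermx_eq0; apply/eqP.
    move: AM0; rewrite /eigenspace => AM0.
    apply/eqP; rewrite -submx0 -AM0; apply/sub_kermxP.
    by rewrite -opprB mulmxN mulmx_ker oppr0.
  have [|z|D D0 BD] := psd_unit_coercive (A := B) _ _ uB.
  - by rewrite linearB/= tr_scalar_mx sA.
  - by rewrite qB subr_ge0.
  (* A unit vector w with M - wA.w < 1/(D + 1) contradicts coercivity, which demands 1 <= D (M -
     wA.w). *)
  have D1 : 0 < (D + 1)^-1 by rewrite invr_gt0; lra.
  have [z z1] := sup_adherent D1 S_sup.
  move: z1 => [w /= w1 <-]; rewrite -/M.
  have := BD w; rewrite qB w1 mulr1 => h1 h2.
  have Dp : 0 < D by nra.
  have : M - dotv (w *m A) w < (D + 1)^-1 by lra.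
  rewrite -div1r ltr_pdivlMr; last lra.
  by have := AM w; rewrite w1 mulr1; nra.
apply: le_trans (AM x) _; apply: ler_wpM2r; first exact: dotv_ge0.
apply: ub_le_sup => //; exists M => a /=; exact: eigenvalue_le.
Qed.

Lemma lambda_max_le (R : realType) (d : nat) (A : 'M[R]_d) K : 0 <= K ->
  (forall x, dotv (x *m A) x <= K * dotv x x) -> lambda_max A <= K.
Proof.
move=> K0 AK; rewrite /lambda_max; set E := [set _ | _].
(* Without eigenvalues the supremum takes its default value 0; this is where 0 <= K enters. *)
have [->|E0] := eqVneq E set0; first by rewrite sup0.
by apply: ge_sup; [exact/set0P|move=> a; exact: eigenvalue_le].
Qed.

(** The Rayleigh bound is tested on the all-ones vector, which is nonzero in positive dimension. In
    dimension 0 there are no eigenvectors and [lambda_max] is the default value 0. *)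
Lemma lambda_max_ge0 (R : realType) (d : nat) (A : 'M[R]_d) : A^T = A ->
  (forall x, 0 <= dotv (x *m A) x) -> 0 <= lambda_max A.
Proof.
case: d A => [|d] A sA A0.
  rewrite /lambda_max (_ : [set _ | _] = set0) ?sup0//.
  apply/seteqP; split => // a /= /eigenvalueP[v _].
  by rewrite [v]thinmx0 eqxx.
have := rayleigh_le_lambda_max (const_mx 1) sA; have := A0 (const_mx 1).
have c0 : 0 < dotv (const_mx 1 : 'rV[R]_d.+1) (const_mx 1).
  rewrite lt_def dotv_ge0 dotv_eq0 andbT.
  by apply/eqP => /rowP/(_ ord0); rewrite !mxE => /eqP; rewrite oner_eq0.
by move=> h1 h2; rewrite -(pmulr_lge0 _ c0) (le_trans h1).
Qed.

(** * Contraction of the mean map *)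

Lemma is_derive_expit (R : realType) (t : R) :
  is_derive t 1 expit (sech (2^-1 * t) ^+ 2 / 4).
Proof.
have e1 : 1 + expR (- t) != 0 by rewrite gt_eqF// addr_gt0// expR_gt0.
have dN : is_derive t 1 (expR \o -%R) (- expR (- t)).
  by apply: is_derive_eq; rewrite mulrN1.
have dD : is_derive t 1 (cst 1 + (expR \o -%R)) (- expR (- t)).
  by apply: is_derive_eq; rewrite add0r.
have := is_deriveV (f := cst 1 + (expR \o -%R)) e1 dD.
set D := (X in is_derive _ _ _ X); set f := (X in is_derive _ _ X D).
have -> : f = expit by [].
move/is_derive_eq; apply; rewrite /D -[(cst 1 + _) t]/(1 + expR (- t)) /sech.
(* In terms of s = exp(t/2) both sides are rational functions, so the identity is left to
   [field]. *)
set s := expR (2^-1 * t); have s0 : s != 0 by rewrite gt_eqF// expR_gt0.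
have -> : expR (- t) = s ^- 2.
  by rewrite -expRM_natl -expRN; congr expR; field.
have s1 : s ^+ 2 + 1 != 0 by rewrite gt_eqF// ltr_wpDl// sqr_ge0.
by rewrite expRN -/s /GRing.scale/=; field; rewrite s1 s0.
Qed.

Section mean_map.
Context {R : realType} {d n : nat}.
Variables (y : 'I_n -> 'rV[R]_d) (p tau tau0 : R).
Hypotheses (tau_gt0 : 0 < tau) (tau0_gt0 : 0 < tau0).
Implicit Types (x c u w : 'rV[R]_d).

Lemma precision_gt0 : 0 < tau0 + n%:R * tau.
Proof. by rewrite ltr_wpDr// mulr_ge0// ltW. Qed.

Let L := ln (p / (1 - p)).

(* The map induced on posterior means by a full sweep of the algorithm. *)
Definition mean_map x : 'rV[R]_d := ((tau0 + n%:R * tau)^-1 * tau) *: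
  \sum_i (2 * expit (L + 2 * tau * dotv (y i) x) - 1) *: y i.

(** The matrix under [lambda_max] in [cavi_rate]; up to the factor tau^2 / (tau0 + n tau) it is the
    Jacobian of [mean_map] at x. *)
Definition sech_gram x : 'M[R]_d :=
  \sum_i sech (2^-1 * L + tau * dotv (y i) x) ^+ 2 *: ((y i)^T *m y i).

Lemma sech_gram_sym x : (sech_gram x)^T = sech_gram x.
Proof.
rewrite /sech_gram raddf_sum; apply: eq_bigr => i _ /=.
by rewrite linearZ/= trmx_mul trmxK.
Qed.

Lemma sech_gramE x w u : dotv (w *m sech_gram x) u =
  \sum_i sech (2^-1 * L + tau * dotv (y i) x) ^+ 2 *
    (dotv (y i) w * dotv (y i) u).
Proof.
rewrite /sech_gram mulmx_sumr dotv_suml; apply: eq_bigr => i _.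
rewrite -scalemxAr dotvZl mulmxA (_ : w *m (y i)^T = (dotv (y i) w)%:M).
  by rewrite mul_scalar_mx dotvZl.
by apply/matrixP => a b; rewrite !ord1 dotvC dotvE [RHS]mxE eqxx mulr1n.
Qed.

Lemma sech_gram_psd x w : 0 <= dotv (w *m sech_gram x) w.
Proof.
rewrite sech_gramE; apply: sumr_ge0 => i _.
by rewrite mulr_ge0 ?sqr_ge0// -expr2 sqr_ge0.
Qed.

Lemma sech_le1 (t : R) : 0 <= sech t <= 1.
Proof.
have e0 := expR_gt0 t; have e0' := expR_gt0 (- t).
rewrite /sech; apply/andP; split; first by rewrite divr_ge0// addr_ge0// ltW.
rewrite ler_pdivrMr ?addr_gt0// mul1r.
have : expR t * expR (- t) = 1 by rewrite -expRD subrr expR0.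
have := sqr_ge0 (expR t - expR (- t)); nra.
Qed.

(** A bound uniform in x, so that the supremum in [cavi_rate] is taken over a bounded set and really
    dominates its elements. It rests on sech^2 <= 1 and (y_i.w)^2 <= |y_i|^2 |w|^2. *)
Lemma lambda_max_sech_gram_le x :
  lambda_max (sech_gram x) <= \sum_i dotv (y i) (y i).
Proof.
apply: lambda_max_le => [|w].
  by apply: sumr_ge0 => i _; exact: dotv_ge0.
rewrite sech_gramE mulr_suml; apply: ler_sum => i _.
rewrite -expr2 (le_trans _ (dotv_cauchy_schwarz _ _))//.
by rewrite ler_piMl ?sqr_ge0// exprn_ile1//; case/andP: (sech_le1 (2^-1 * L + tau * dotv (y i) x)).
Qed.

Let sups c eps := sup [set lambda_max (sech_gram x)
  | x in [set x : 'rV[R]_d | enorm (x - c) <= eps]].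

Let sups_ub c eps x : enorm (x - c) <= eps ->
  lambda_max (sech_gram x) <= sups c eps.
Proof.
move=> xc; apply: ub_le_sup; last by exists x.
by exists (\sum_i dotv (y i) (y i)) => _ [z _ <-]; exact: lambda_max_sech_gram_le.
Qed.

Lemma lambda_max_le_cavi_rate c eps x : enorm (x - c) <= eps ->
  (tau0 + n%:R * tau)^-1 * tau ^+ 2 * lambda_max (sech_gram x)
    <= cavi_rate y p tau tau0 c eps.
Proof.
move=> /sups_ub xc; rewrite /cavi_rate -/(sups c eps) (mulrC tau n%:R).
rewrite (mulrC _ (tau ^+ 2)) ler_wpM2l// divr_ge0 ?sqr_ge0//.
exact/ltW/precision_gt0.
Qed.

Lemma cavi_rate_ge0 c eps : 0 <= eps -> 0 <= cavi_rate y p tau tau0 c eps.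
Proof.
move=> eps0; have cc : enorm (c - c) <= eps by rewrite subrr /enorm dotv0l sqrtr0.
apply: le_trans (lambda_max_le_cavi_rate cc).
rewrite mulr_ge0//.
  by rewrite mulr_ge0 ?sqr_ge0 ?invr_ge0 ?(ltW precision_gt0).
apply: lambda_max_ge0; [exact: sech_gram_sym|exact: sech_gram_psd].
Qed.

(** Restricting to a line and pairing with a fixed w leaves a scalar function of one variable, a sum
    of sigmoids of affine functions, to which the real mean value theorem applies. *)
Lemma is_derive_mean_map c u w (s : R) :
  is_derive s 1 (fun t => dotv (mean_map (c + t *: u)) w)
    ((tau0 + n%:R * tau)^-1 * tau ^+ 2 *
     dotv (w *m sech_gram (c + s *: u)) u).
Proof.
pose g i (t : R) := expit (L + 2 * tau * dotv (y i) (c + t *: u)).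
have dg i : is_derive s 1 (g i)
    (2^-1 * tau * dotv (y i) u * sech (2^-1 * L + tau * dotv (y i) (c + s *: u)) ^+ 2).
  pose a i (t : R) := (L + 2 * tau * dotv (y i) c) + (2 * tau * dotv (y i) u) * t.
  have da : is_derive s 1 (a i) (2 * tau * dotv (y i) u).
    rewrite (_ : a i = cst (L + 2 * tau * dotv (y i) c) +
      (2 * tau * dotv (y i) u) *: id)//.
    by apply: is_derive_eq; rewrite add0r /GRing.scale/= mulr1.
  have gE : g i = expit \o a i.
    by apply/funext => t; rewrite /g /a /= dotvDr dotvZr; congr expit; ring.
  have := is_derive1_comp (is_derive_expit (a i s)) da.
  rewrite gE => /is_derive_eq; apply.
  (* Halving the logit L + 2 tau y_i.x yields exactly the argument of sech in [cavi_rate]. *)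
  rewrite (_ : 2^-1 * a i s = 2^-1 * L + tau * dotv (y i) (c + s *: u)).
    by field.
  by rewrite /a dotvDr dotvZr; field.
pose k i := (tau0 + n%:R * tau)^-1 * tau * dotv (y i) w.
have -> : (fun t => dotv (mean_map (c + t *: u)) w) =
    \sum_(i < n) ((2 * k i) *: g i - cst (k i)).
  apply/funext => t; rewrite /mean_map dotvZl dotv_suml mulr_sumr fct_sumE.
  by apply: eq_bigr => i _; rewrite [RHS](_ : _ = 2 * k i * g i t - k i)// dotvZl /k /g; ring.
have dk i : is_derive s 1 ((2 * k i) *: g i - cst (k i)) _ :=
  is_deriveB (is_deriveZ (2 * k i) (dg i)) (is_derive_cst (k i) s 1).
have /is_derive_eq := is_derive_sum dk; apply.
rewrite sech_gramE mulr_sumr; apply: eq_bigr => i _.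
by rewrite subr0 /k /GRing.scale/=; field; rewrite gt_eqF ?precision_gt0.
Qed.

(** A vector-valued map has no single mean value point, so the map is paired with w = F(x) - F(c)
    itself: |w|^2 = k (wA.u), with A taken at one point of the segment. Cauchy-Schwarz for A and the
    Rayleigh bound give |w|^2 <= k lambda_max(A) |w| |u|. *)
Lemma mean_map_contraction c eps x : enorm (x - c) <= eps ->
  enorm (mean_map x - mean_map c) <= cavi_rate y p tau tau0 c eps * enorm (x - c).
Proof.
move=> xc; set w := mean_map x - mean_map c; set u := x - c.
have eps0 : 0 <= eps := le_trans (enorm_ge0 _) xc.
set r := cavi_rate _ _ _ _ _ _; have r0 : 0 <= r by exact: cavi_rate_ge0.
have [s s01 ws] : exists2 s : R, s \in `[0, 1]%R &
    dotv w w = (tau0 + n%:R * tau)^-1 * tau ^+ 2 *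
      dotv (w *m sech_gram (c + s *: u)) u.
  have [||s s01 E] := @MVT_segment R (fun t => dotv (mean_map (c + t *: u)) w)
    (fun s => (tau0 + n%:R * tau)^-1 * tau ^+ 2 *
      dotv (w *m sech_gram (c + s *: u)) u) 0 1 ler01.
  - by move=> s _; exact: is_derive_mean_map.
  - apply: derivable_within_continuous => s _.
    by have [] := is_derive_mean_map c u w s.
  exists s => //; move: E; rewrite subr0 mulr1 => <-.
  by rewrite scale1r scale0r addr0 /u subrKC -dotvBl.
(* The mean value point lies between c and x, hence in the ball over which the supremum is taken. *)
have cu : enorm (c + s *: u - c) <= eps.
  rewrite addrAC subrr add0r; apply: le_trans xc; rewrite -/u /enorm dotvZl dotvZr.
  rewrite ler_wsqrtr// mulrA ler_piMl ?dotv_ge0//.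
  by move: s01; rewrite in_itv/= => /andP[? ?]; nra.
move: ws (lambda_max_le_cavi_rate cu); rewrite -/r.
have k0 : 0 <= (tau0 + n%:R * tau)^-1 * tau ^+ 2.
  by rewrite mulr_ge0 ?sqr_ge0// invr_ge0 ltW ?precision_gt0.
set k := (tau0 + n%:R * tau)^-1 * tau ^+ 2 in k0 *.
set A := sech_gram _ => ws kA.
have A0 : 0 <= lambda_max A.
  by apply: lambda_max_ge0; [exact: sech_gram_sym|exact: sech_gram_psd].
have Aq z : dotv (z *m A) z <= lambda_max A * dotv z z.
  by apply: rayleigh_le_lambda_max; exact: sech_gram_sym.
have wAu : dotv (w *m A) u ^+ 2 <= lambda_max A ^+ 2 * (dotv w w * dotv u u).
  apply: le_trans (psd_cauchy_schwarz _ _ (sech_gram_sym _) (@sech_gram_psd _)) _.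
  by rewrite expr2 mulrACA ler_pM ?sech_gram_psd.
(* The estimate is kept squared to avoid square roots; the common factor |w|^2 is cancelled at the
   end, apart from the trivial case w = 0. *)
have ww : dotv w w ^+ 2 <= dotv w w * (r ^+ 2 * dotv u u).
  rewrite {1}ws exprMn (le_trans (ler_wpM2l (sqr_ge0 _) wAu))//.
  rewrite [leLHS](_ : _ = dotv w w * ((k * lambda_max A) ^+ 2 * dotv u u)); last by ring.
  rewrite ler_wpM2l ?dotv_ge0// ler_wpM2r ?dotv_ge0//.
  by rewrite lerXn2r ?nnegrE// mulr_ge0.
rewrite -(ler_pXn2r (n := 2)) ?nnegrE ?(mulr_ge0 r0) ?enorm_ge0//.
rewrite exprMn !enorm_sqr.
have := dotv_ge0 w; rewrite le_eqVlt => /predU1P[<-|w0].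
  by rewrite mulr_ge0 ?sqr_ge0 ?dotv_ge0.
by rewrite -(ler_pM2l w0) -expr2.
Qed.
End mean_map.

(** * Invariance of the Lebesgue measure *)

Lemma measurable_fun_row d (T : measurableType d) d' (T' : measurableType d') n
    (f : T' -> 'rV[T]_n) : (forall i, measurable_fun setT (fun x => f x ord0 i)) ->
  measurable_fun setT f.
Proof.
move=> mf.
rewrite (_ : f = @row_of_tuple T n \o (fun x => [tuple f x ord0 i | i < n])).
  apply: measurableT_comp; first exact: measurable_row_of_tuple.
  apply/measurable_fun_tnthP => i.
  by rewrite (_ : _ \o _ = fun x => f x ord0 i)//; apply/funext => x /=; rewrite tnth_mktuple.
by apply/funext => x; apply/rowP => i; rewrite mxE tnth_mktuple.
Qed.

Section measure_preserving.
Context d (T : measurableType d) (R : realType).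
Local Open Scope ereal_scope.

Lemma ge0_integral_preserving (m : {measure set T -> \bar R}) (phi : T -> T)
    (f : T -> \bar R) :
  measurable_fun setT phi ->
  (forall A, measurable A -> m (phi @^-1` A) = m A) ->
  measurable_fun setT f -> (forall x, 0 <= f x) ->
  \int[m]_x f (phi x) = \int[m]_x f x.
Proof.
move=> mphi pm mf f0.
rewrite [RHS](eq_measure_integral (pushforward m phi)) => [|A mA _]; last exact/esym/pm.
by rewrite [RHS]ge0_integral_pushforward.
Qed.

Lemma ge0_integral_cons_measure n (m1 : {sigma_finite_measure set T -> \bar R})
    (m2 : {sigma_finite_measure set n.-tuple T -> \bar R}) (f : n.+1.-tuple T -> \bar R) :
  measurable_fun setT f -> (forall t, 0 <= f t) ->
  \int[cons_measure m1 m2]_t f t = \int[m1]_x \int[m2]_t f [tuple of x :: t].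
Proof.
move=> mf f0; rewrite ge0_integral_pushforward//=; last exact: measurable_cons_pair.
rewrite preimage_setT fubini_tonelli1//=.
exact: measurableT_comp mf (@measurable_cons_pair _ _ _).
Qed.

(** Induction on n by Tonelli: the outer integral absorbs the map on the head, and for each fixed
    head the induction hypothesis absorbs the maps on the tail. *)
Lemma ge0_integral_tuple_prod_preserving n
    (m : 'I_n -> {sigma_finite_measure set T -> \bar R}) (phi : 'I_n -> T -> T)
    (f : n.-tuple T -> \bar R) :
  (forall i, measurable_fun setT (phi i)) ->
  (forall i A, measurable A -> m i (phi i @^-1` A) = m i A) ->
  measurable_fun setT f -> (forall t, 0 <= f t) ->
  \int[tuple_prod m]_t f [tuple phi i (tnth t i) | i < n] =
  \int[tuple_prod m]_t f t.
Proof.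
elim: n m phi f => [|n IHn] m phi f mphi pm mf f0.
  by apply: eq_integral => t _; congr f; rewrite [LHS]tuple0 [RHS]tuple0.
have mPhi k (psi : 'I_k -> T -> T) : (forall i, measurable_fun setT (psi i)) ->
    measurable_fun setT (fun t : k.-tuple T => [tuple psi i (tnth t i) | i < k]).
  move=> mpsi; apply/measurable_fun_tnthP => i.
  rewrite (_ : _ \o _ = psi i \o (@tnth _ T ^~ i)).
    by apply: measurableT_comp => //; exact: measurable_tnth.
  by apply/funext => t /=; rewrite tnth_mktuple.
pose m' i := m (lift ord0 i); pose phi' i := phi (lift ord0 i).
pose Phi' (t : n.-tuple T) := [tuple phi' i (tnth t i) | i < n].
have E g : measurable_fun setT g -> (forall t, 0 <= g t) ->
    \int[tuple_prod m]_t g t = \int[m ord0]_x \int[tuple_prod m']_t g [tuple of x :: t].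
  exact: ge0_integral_cons_measure.
have consE (x : T) (t : n.-tuple T) : [tuple phi i (tnth [tuple of x :: t] i) | i < n.+1] =
    [tuple of phi ord0 x :: Phi' t].
  apply: eq_from_tnth => i; rewrite tnth_mktuple.
  have [j ->|->] := unliftP ord0 i; last by rewrite !tnth0.
  by rewrite !tnthS tnth_mktuple.
(* Joint measurability makes the inner integral a measurable function of the head, as the change of
   variables there requires. *)
have mG : measurable_fun setT
    (fun z : T * n.-tuple T => f [tuple of z.1 :: Phi' z.2]).
  apply: measurableT_comp mf _; apply: measurable_cons => //.
  by apply: measurableT_comp (mPhi _ phi' _) _ => // i; exact: mphi.
rewrite !E//; last exact: measurableT_comp mf (mPhi _ _ mphi).
transitivity (\int[m ord0]_x \int[tuple_prod m']_t f [tuple of x :: Phi' t]).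
  rewrite -[RHS](ge0_integral_preserving (mphi ord0) (pm ord0)).
  - by apply: eq_integral => x _; apply: eq_integral => t _; rewrite consE.
  - exact: (measurable_fun_fubini_tonelli_F _ mG).
  - by move=> x; apply: integral_ge0 => t _.
apply: eq_integral => x _.
apply: (IHn m' phi' (fun t => f [tuple of x :: t])) => //.
- by move=> i; exact: mphi.
- by move=> i; exact: pm.
- by apply: measurableT_comp mf _; exact: measurable_cons.
Qed.

End measure_preserving.

(** The image of Lebesgue measure under the shift gives every half-open interval its length, and
    this determines the measure. *)
Lemma lebesgue_measure_shift (R : realType) (a : R) (A : set R) :
  measurable A -> lebesgue_measure ((fun x => x + a) @^-1` A) = lebesgue_measure A.
Proof.
move=> mA; have ms : measurable_fun setT
    ((fun x => x + a) : measurableTypeR R -> measurableTypeR R).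
  exact: measurable_funD.
pose ms_ := isMeasurableFun.Build _ _ _ _ _ ms.
pose s : {mfun measurableTypeR R >-> measurableTypeR R} :=
  HB.pack ((fun x => x + a) : measurableTypeR R -> measurableTypeR R) ms_.
apply/esym.
apply: (lebesgue_measure_unique (mu := pushforward (@lebesgue_measure R) s)) =>
  //= _ [[b c]] _ <-.
rewrite /pushforward (_ : _ @^-1` _ = `]b - a, c - a]%classic).
  rewrite !lebesgue_measure_itv/= !lte_fin ltrD2r; case: ifP => // _.
  by rewrite -!EFinD; congr EFin; ring.
by apply/seteqP; split => x /=; rewrite !in_itv/= ltrBlDr lerBrDr.
Qed.

(** The reflection is negation followed by a shift, both of which preserve the measure. *)
Lemma lebesgue_measure_reflect (R : realType) (a : R) (A : set R) :
  measurable A -> lebesgue_measure ((fun x => a - x) @^-1` A) = lebesgue_measure A.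
Proof.
move=> mA; have ms : measurable_fun setT
    ((fun x => x + a) : measurableTypeR R -> measurableTypeR R).
  exact: measurable_funD.
have mB : measurable
    (((fun x => x + a) : measurableTypeR R -> measurableTypeR R) @^-1` A).
  by rewrite -[X in measurable X]setTI; exact: ms.
rewrite -[RHS](lebesgue_measure_shift a)// -[RHS]lebesgue_measureN// /pushforward.
by congr (lebesgue_measure _); apply/seteqP; split => x /=; rewrite addrC.
Qed.

Section lebesgue_rV_preserving.
Context {R : realType} {d : nat}.

Lemma ge0_integral_lebesgue_rV (f : 'rV[R]_d -> \bar R) :
  measurable_fun setT f -> (forall x, 0 <= f x)%E ->
  (\int[lebesgue_rV d]_x f x =
   \int[tuple_prod (fun=> @lebesgue_measure R)]_t f (row_of_tuple t))%E.
Proof.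
move=> mf f0; rewrite ge0_integral_pushforward//=.
exact: measurable_row_of_tuple.
Qed.

(** Allowing an arbitrary preserving map in each coordinate covers translations and point
    reflections of the space at once. *)
Lemma ge0_integral_lebesgue_rV_preserving (phi : 'I_d -> R -> R)
    (f : 'rV[R]_d -> \bar R) :
  (forall i, measurable_fun setT (phi i)) ->
  (forall i A, measurable A -> lebesgue_measure (phi i @^-1` A) = lebesgue_measure A) ->
  measurable_fun setT f -> (forall x, 0 <= f x)%E ->
  (\int[lebesgue_rV d]_x f (\row_i phi i (x ord0 i)) = \int[lebesgue_rV d]_x f x)%E.
Proof.
move=> mphi pm mf f0; rewrite !ge0_integral_lebesgue_rV//; last first.
  apply: measurableT_comp mf _; apply: measurable_fun_row => i.
  under eq_fun do rewrite mxE.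
  by apply: measurableT_comp => //; exact: measurable_coord.
rewrite -[RHS](@ge0_integral_tuple_prod_preserving _ _ _ _ (fun=> @lebesgue_measure R) phi)//=.
  apply: eq_integral => t _ /=; congr f; apply/rowP => i.
  by rewrite !mxE tnth_mktuple.
exact: measurableT_comp mf (@measurable_row_of_tuple _ _ _).
Qed.
End lebesgue_rV_preserving.

(** * Gaussian measures *)

Section density.
Import HBNNSimple.

(* Every admissible f is an increasing limit of simple functions, for which the
   identity is the definition of nu. *)
Lemma ge0_integral_density d (T : measurableType d) (R : realType)
    (mu nu : {measure set T -> \bar R}) (g : T -> R) (f : T -> R) :
  measurable_fun setT g -> (forall x, 0 <= g x) ->
  (forall A, measurable A -> nu A = (\int[mu]_(x in A) (g x)%:E)%E) ->
  measurable_fun setT f -> (forall x, 0 <= f x) ->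
  (\int[nu]_x (f x)%:E = \int[mu]_x (f x * g x)%:E)%E.
Proof.
move=> mg g0 nuE mf f0.
have mf' : measurable_fun setT (EFin \o f) by exact/measurable_EFinP.
pose h := nnsfun_approx measurableT mf'.
have hf x : (h n x)%:E @[n --> \oo] --> (f x)%:E.
  by apply: cvg_nnsfun_approx => // y _; rewrite lee_fin.
have ndh x : nondecreasing_seq (fun n => h n x).
  by move=> a b ab; exact/lefP/nd_nnsfun_approx.
have -> : (\int[nu]_x (f x)%:E = limn (fun n => \int[nu]_x (h n x)%:E))%E.
  rewrite -monotone_convergence//.
  - by apply: eq_integral => x _; apply/esym/cvg_lim => //; exact: hf.
  - by move=> n; exact/measurable_EFinP.
  - by move=> n x _; rewrite lee_fin.
  - by move=> x _ a b ab; rewrite lee_fin ndh.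
have -> : (\int[mu]_x (f x * g x)%:E = limn (fun n => \int[mu]_x (h n x * g x)%:E))%E.
  rewrite -monotone_convergence//.
  - apply: eq_integral => x _; apply/esym/cvg_lim => //.
    under eq_fun do rewrite EFinM.
    by rewrite EFinM; apply: cvgeZr => //; exact: hf.
  - by move=> n; apply/measurable_EFinP; exact: measurable_funM.
  - by move=> n x _; rewrite lee_fin mulr_ge0.
  - by move=> x _ a b ab; rewrite lee_fin ler_wpM2r// ndh.
congr (limn _); apply/funext => n.
have mhr r : measurable (h n @^-1` [set r]) by [].
transitivity (\sum_(r \in range (h n)) r%:E * nu (h n @^-1` [set r]))%E.
  by rewrite integralT_nnsfun sintegralE.
(* Splits the integrand over the level sets of the simple function; at each x only the term r = h n
   x survives. *)
have -> : (fun x => (h n x * g x)%:E) = (fun x =>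
    \sum_(r \in range (h n)) (r%:E * ((EFin \o g) \_ (h n @^-1` [set r])) x))%E.
  apply/funext => x.
  rewrite (fsbigD1 (h n x))//=; last by exists x.
  rewrite fsbig1 ?adde0 => [|r /= [_ rx]].
    by rewrite patchE mem_set.
  by rewrite patchE memNset ?mule0//=; exact/nesym.
rewrite ge0_integral_fsum//; last 2 first.
- move=> r; apply: measurable_funeM.
  by apply/(measurable_restrictT _ _).1 => //; exact/measurable_EFinP/measurable_funTS.
- move=> r x _; rewrite patchE; case: ifPn => [/set_mem/= <-|_]; last by rewrite mule0.
  by rewrite mule_ge0// lee_fin.
apply: eq_fsbigr => r /set_mem[x _ <-].
rewrite ge0_integralZl//=; last 3 first.
- by apply/(measurable_restrictT _ _).1 => //; exact/measurable_EFinP/measurable_funTS.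
- by move=> y _; rewrite patchE; case: ifPn => //= _; rewrite lee_fin.
- by rewrite lee_fin.
by rewrite nuE// integral_mkcond.
Qed.

End density.

Lemma measurable_dotv (R : realType) d' (T : measurableType d') d (f g : T -> 'rV[R]_d) :
  measurable_fun setT f -> measurable_fun setT g ->
  measurable_fun setT (fun x => dotv (f x) (g x)).
Proof.
move=> mf mg; apply: measurable_sum => i.
by apply: measurable_funM; apply: (measurableT_comp (measurable_coord i)).
Qed.

Lemma measurable_enorm_sqr (R : realType) d' (T : measurableType d') d (f : T -> 'rV[R]_d) :
  measurable_fun setT f -> measurable_fun setT (fun x => enorm (f x) ^+ 2).
Proof.
by move=> mf; under eq_fun do rewrite enorm_sqr; exact: measurable_dotv.
Qed.

Section gaussian_moments.
Context {R : realType} {d : nat}.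
Implicit Types (m x : 'rV[R]_d) (v : R).

Lemma enormN x : enorm (- x) = enorm x.
Proof. by rewrite /enorm dotvNl dotvC dotvNl opprK. Qed.

(** The density depends on x only through |x - m|, so a Lebesgue-preserving map that turns distances
    to m into distances to m' transports one Gaussian to the other. *)
Lemma gaussian_preserving m m' v (phi : 'I_d -> R -> R) A : 0 < v ->
  (forall i, measurable_fun setT (phi i)) ->
  (forall i A, measurable A -> lebesgue_measure (phi i @^-1` A) = lebesgue_measure A) ->
  (forall x, enorm (\row_i phi i (x ord0 i) - m') = enorm (x - m)) ->
  measurable A ->
  gaussian m v ((fun x => \row_i phi i (x ord0 i)) @^-1` A) = gaussian m' v A.
Proof.
move=> v0 mphi pm dm mA; rewrite /gaussian v0 integral_mkcond [RHS]integral_mkcond.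
pose f : 'rV[R]_d -> \bar R := (fun x => (gauss_pdf m' v x)%:E) \_ A.
transitivity (\int[lebesgue_rV d]_x f (\row_i phi i (x ord0 i)))%E.
  apply: eq_integral => x _; rewrite /f !patchE /gauss_pdf dm.
  by congr (if _ then _ else _); apply/idP/idP => /set_mem ?; apply/mem_set.
rewrite ge0_integral_lebesgue_rV_preserving//.
- apply/(measurable_restrictT _ _).1 => //; apply: measurable_funTS.
  by apply/measurable_EFinP; exact: measurable_gauss_pdf.
- by move=> x; rewrite /f patchE; case: ifPn => // _; rewrite lee_fin gauss_pdf_ge0.
Qed.

Lemma gaussian_shift m a v A : 0 < v -> measurable A ->
  gaussian m v ((fun x => x + a) @^-1` A) = gaussian (m + a) v A.
Proof.
move=> v0 mA.
rewrite (_ : (fun x => x + a) = fun x => \row_i (x ord0 i + a ord0 i)); last first.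
  by apply/funext => x; apply/rowP => i; rewrite !mxE.
apply: (@gaussian_preserving m _ _ (fun i t => t + a ord0 i)) => //.
- by move=> i; exact: measurable_funD.
- by move=> i B mB; exact: lebesgue_measure_shift.
- by move=> x; congr enorm; apply/rowP => i; rewrite !mxE; ring.
Qed.

Lemma gaussian_reflect m v A : 0 < v -> measurable A ->
  gaussian m v ((fun x => m + m - x) @^-1` A) = gaussian m v A.
Proof.
move=> v0 mA.
rewrite (_ : (fun x => m + m - x) = fun x => \row_i ((m + m) ord0 i - x ord0 i)); last first.
  by apply/funext => x; apply/rowP => i; rewrite !mxE.
apply: (@gaussian_preserving m _ _ (fun i t => (m + m) ord0 i - t)) => //.
- by move=> i; exact: measurable_funB.
- by move=> i B mB; exact: lebesgue_measure_reflect.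
- by move=> x; rewrite -[RHS]enormN; congr enorm; apply/rowP => i; rewrite !mxE; ring.
Qed.

(* |x - m|^2 exp(-|x - m|^2 / 2v) is dominated by a multiple of
   exp(-|x - m|^2 / 4v), the unnormalised density of N(m, 2v I). *)
Lemma gaussian_variance_lt_pinfty m v : 0 < v ->
  (\int[gaussian m v]_x (enorm (x - m) ^+ 2)%:E < +oo)%E.
Proof.
move=> v0; have v20 : 0 < 2 * v by rewrite mulr_gt0.
have mB : measurable_fun setT (fun x => x - m).
  apply: measurable_fun_row => i; under eq_fun do rewrite !mxE.
  by apply: measurable_funB => //; exact: measurable_coord.
rewrite (ge0_integral_density (mu := lebesgue_rV d)
  (measurable_gauss_pdf m v) (@gauss_pdf_ge0 _ _ m v)).
(* The factor 4 v comes from s <= exp(s) at s = |x - m|^2 / 4v; the rest is the ratio of the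
   normalising constants for variances v and 2v. *)
- pose C := 4 * v * (Num.sqrt (2 * pi * v))^-1 ^+ d / (Num.sqrt (2 * pi * (2 * v)))^-1 ^+ d.
  have C0 : 0 <= C.
    by rewrite /C divr_ge0 ?mulr_ge0 ?exprn_ge0 ?invr_ge0 ?sqrtr_ge0 ?(ltW v0).
  apply: (@le_lt_trans _ _ (\int[lebesgue_rV d]_x (C%:E * (gauss_pdf m (2 * v) x)%:E))%E).
    apply: ge0_le_integral => //.
    + by move=> x _; rewrite lee_fin mulr_ge0 ?sqr_ge0// gauss_pdf_ge0.
    + apply/measurable_EFinP/measurable_funM; last exact: measurable_gauss_pdf.
      exact: measurable_enorm_sqr.
    + apply: measurable_funeM.
      by apply/measurable_EFinP; exact: measurable_gauss_pdf.
    + move=> x _; rewrite -EFinM lee_fin /gauss_pdf /C.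
      set e := enorm (x - m) ^+ 2; set a := _ ^+ d; set b := _ ^+ d.
      have b0 : b != 0.
        by rewrite gt_eqF// exprn_gt0// invr_gt0 sqrtr_gt0 !mulr_gt0 ?pi_gt0.
      have a0 : 0 <= a by rewrite exprn_ge0// invr_ge0 sqrtr_ge0.
      have -> : 4 * v * a / b * (b * expR (- e / (2 * (2 * v)))) =
          a * (4 * v * expR (- e / (2 * (2 * v)))) by field.
      rewrite mulrCA ler_wpM2l//.
      (* The claim becomes 4 v s exp(-2s) <= 4 v exp(-s). *)
      pose s := e / (4 * v).
      have -> : - e / (2 * v) = - s + - s by rewrite /s; field; rewrite gt_eqF.
      have -> : - e / (2 * (2 * v)) = - s by rewrite /s; field; rewrite gt_eqF.
      have -> : e = 4 * v * s by rewrite /s; field; rewrite gt_eqF.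
      rewrite -[leLHS]mulrA ler_wpM2l ?mulr_ge0 ?(ltW v0)// expRD mulrA ler_piMl ?expR_ge0//.
      rewrite expRN ler_pdivrMr ?expR_gt0// mul1r.
      by apply: le_trans (expR_ge1Dx s); rewrite lerDr.
  rewrite ge0_integralZl//=.
  + by rewrite integral_gauss_pdf// mule1 ltry.
  + by apply/measurable_EFinP; exact: measurable_gauss_pdf.
  + by move=> x _; rewrite lee_fin gauss_pdf_ge0.
- by move=> A mA; rewrite /= /gaussian v0.
- exact: measurable_enorm_sqr.
- by move=> x; exact: sqr_ge0.
Qed.

End gaussian_moments.

(** * Means and couplings *)

Section means_and_couplings.
Context {R : realType} {d : nat}.
Implicit Types (P Q mu nu : probability 'rV[R]_d R) (m u x : 'rV[R]_d) (v : R).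

Definition finite_second_moment P :=
  (\int[P]_x (enorm x ^+ 2)%:E < +oo)%E.

Lemma dotv_young u x : 2 * dotv u x <= enorm u ^+ 2 + enorm x ^+ 2.
Proof.
rewrite !enorm_sqr; have := dotv_ge0 (u - x).
by rewrite dotvBl !dotvBr (dotvC x u); lra.
Qed.

Lemma le_norm_dotv u x : `|dotv u x| <= enorm u ^+ 2 + enorm x ^+ 2.
Proof.
have := sqr_ge0 (enorm u); have := sqr_ge0 (enorm x).
have := dotv_young u x; have := dotv_young (- u) x; rewrite dotvNl enormN ler_norml.
by move=> *; apply/andP; split; lra.
Qed.

Lemma integrable_enorm_sqr P : finite_second_moment P ->
  P.-integrable setT (fun x => (enorm x ^+ 2)%:E).
Proof.
move=> P2; apply/integrableP; split.
  by apply/measurable_EFinP; exact: measurable_enorm_sqr.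
under eq_integral do rewrite gee0_abs ?lee_fin ?sqr_ge0//.
exact: P2.
Qed.

Lemma integrable_dotv P u : finite_second_moment P ->
  P.-integrable setT (fun x => (dotv u x)%:E).
Proof.
move=> P2.
apply: (@le_integrable _ _ _ _ _ _ _
  (fun x => (enorm u ^+ 2)%:E + (enorm x ^+ 2)%:E)%E) => //.
- by apply/measurable_EFinP; exact: measurable_dotv.
- move=> x _; rewrite -EFinD !abse_EFin lee_fin [leRHS]ger0_norm ?le_norm_dotv//.
  by rewrite addr_ge0 ?sqr_ge0.
- apply: integrableD => //; last exact: integrable_enorm_sqr.
  exact: finite_measure_integrable_cst.
Qed.

Lemma dotv_delta j x : dotv (delta_mx 0 j) x = x ord0 j.
Proof.
rewrite /dotv (bigD1 j)//= big1 ?addr0 => [|i /negbTE ij].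
  by rewrite mxE !eqxx mul1r.
by rewrite mxE ij andbF mul0r.
Qed.

(** By linearity over coordinates; each coordinate is integrable, so the [fine] inside [mean] loses
    nothing. *)
Lemma integral_dotv_mean P u : finite_second_moment P ->
  (\int[P]_x (dotv u x)%:E = (dotv u (mean P))%:E)%E.
Proof.
move=> P2.
have intj j : P.-integrable setT (fun x : 'rV[R]_d => (x ord0 j)%:E).
  by under eq_fun do rewrite -dotv_delta; exact: integrable_dotv.
transitivity (\int[P]_x \sum_(j < d) ((u ord0 j)%:E * (x ord0 j)%:E))%E.
  by apply: eq_integral => x _; rewrite /dotv sumEFin.
rewrite integral_sum// => [|j]; last exact: integrableZl.
rewrite /dotv -sumEFin; apply: eq_bigr => j _.
rewrite integralZl// EFinM mxE unlock fineK//.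
exact: integrable_fin_num.
Qed.

(** The fixed-point equation is an equality on measurable sets rather than of bundled probabilities,
    so properties are carried across it by such lemmas. *)
Lemma eq_mean P Q : (forall A, measurable A -> P A = Q A) -> mean P = mean Q.
Proof.
move=> PQ; apply/rowP => j; rewrite !mxE !unlock; congr fine.
by apply: eq_measure_integral => A mA _; exact: PQ.
Qed.

Lemma eq_finite_second_moment P Q : (forall A, measurable A -> P A = Q A) ->
  finite_second_moment P -> finite_second_moment Q.
Proof.
by move=> PQ; rewrite /finite_second_moment (eq_measure_integral Q)// => A mA _; exact: PQ.
Qed.

(** Follows from the finite variance by |x|^2 <= 2 |x - m|^2 + 2 |m|^2. *)
Lemma gaussian_finite_second_moment m v : 0 < v ->
  finite_second_moment (gaussian m v).
Proof.
move=> v0; have mB : measurable_fun setT (fun x => x - m).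
  apply: measurable_fun_row => i; under eq_fun do rewrite !mxE.
  by apply: measurable_funB => //; exact: measurable_coord.
apply: (@le_lt_trans _ _ (\int[gaussian m v]_x
    (2%:E * (enorm (x - m) ^+ 2)%:E + (2 * enorm m ^+ 2)%:E))%E).
  apply: ge0_le_integral => //=.
  - by move=> x _; rewrite lee_fin sqr_ge0.
  - by apply/measurable_EFinP; exact: measurable_enorm_sqr.
  - apply: emeasurable_funD => //; apply: measurable_funeM.
    by apply/measurable_EFinP; exact: measurable_enorm_sqr.
  - move=> x _; rewrite -EFinM -EFinD lee_fin !enorm_sqr.
    rewrite -{1 2}(subrK m x); move: (x - m) => w.
    have := dotv_ge0 (w - m); rewrite !(dotvBl, dotvBr, dotvDl, dotvDr) (dotvC m w).
    lra.
rewrite ge0_integralD//=; last 3 first.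
- by move=> x _; rewrite mule_ge0// lee_fin sqr_ge0.
- by apply: measurable_funeM; apply/measurable_EFinP; exact: measurable_enorm_sqr.
- by move=> x _; rewrite lee_fin mulr_ge0// sqr_ge0.
rewrite lte_add_pinfty//.
  rewrite ge0_integralZl//=; last 2 first.
  - by apply/measurable_EFinP; exact: measurable_enorm_sqr.
  - by move=> x _; rewrite lee_fin sqr_ge0.
  by rewrite lte_mul_pinfty// gaussian_variance_lt_pinfty.
by rewrite integral_cst// [X in (_ * X)%E]probability_setT mule1 ltry.
Qed.

(** Change of variables for a map whose law is known only through its values on measurable sets; it
    serves both the marginals of a coupling and the reflection of a Gaussian. *)
Lemma integral_marginal d' (T : measurableType d') (g : probability T R)
    (phi : T -> 'rV[R]_d) P (f : 'rV[R]_d -> R) :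
  measurable_fun setT phi ->
  (forall A, measurable A -> g (phi @^-1` A) = P A) ->
  P.-integrable setT (EFin \o f) ->
  g.-integrable setT (EFin \o (f \o phi)) /\
  (\int[g]_z (f (phi z))%:E = \int[P]_x (f x)%:E)%E.
Proof.
move=> mphi gP /integrableP[mf fP].
have E h : (\int[P]_x h x = \int[pushforward g phi]_x h x)%E.
  by apply: eq_measure_integral => A mA _; exact/esym/gP.
have gf : g.-integrable setT ((EFin \o f) \o phi).
  apply/integrableP; split; first exact: measurableT_comp.
  move: fP; rewrite E ge0_integral_pushforward//.
  exact: measurableT_comp.
by split => //; rewrite E (integral_pushforward mphi mf).
Qed.

(** The law is invariant under x -> 2m - x, so u.mean = 2 u.m - u.mean for every u; the choice u =
    mean - m gives |u|^2 = 0. *)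
Lemma mean_gaussian m v : 0 < v -> mean (gaussian m v) = m.
Proof.
move=> v0; have G2 := gaussian_finite_second_moment m v0.
set P : probability _ _ := gaussian m v; set u := mean P - m.
have mr : measurable_fun setT (fun x => m + m - x).
  apply: measurable_fun_row => i; under eq_fun do rewrite !mxE.
  by apply: measurable_funB => //; exact: measurable_coord.
have [_] := integral_marginal mr (@gaussian_reflect _ _ m v ^~ v0) (integrable_dotv u G2).
rewrite (_ : (fun _ => _) = (fun x => (dotv u (m + m))%:E - (dotv u x)%:E)%E); last first.
  by apply/funext => x; rewrite dotvBr.
rewrite integralB//; last 2 first.
- exact: finite_measure_integrable_cst.
- exact: integrable_dotv.
rewrite integral_cst// [X in (_ * X)%E]probability_setT mule1.
rewrite integral_dotv_mean// -EFinB => -[] e.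
apply/eqP; rewrite -subr_eq0 -dotv_eq0 -/P -/u {2}/u dotvBr.
by move: e; rewrite dotvDr => e; apply/eqP; lra.
Qed.

Lemma mean_le_coupling mu nu g :
  finite_second_moment mu -> finite_second_moment nu -> is_coupling mu nu g ->
  ((enorm (mean mu - mean nu) ^+ 2)%:E <= \int[g]_z (enorm (z.1 - z.2) ^+ 2)%:E)%E.
Proof.
move=> mu2 nu2 gc; set u := mean mu - mean nu.
have g1 A : measurable A -> g (fst @^-1` A) = mu A.
  move=> mA; have [<- _] := gc A mA; congr (g _).
  by apply/seteqP; split => [[x y]|[x y] []].
have g2 A : measurable A -> g (snd @^-1` A) = nu A.
  move=> mA; have [_ <-] := gc A mA; congr (g _).
  by apply/seteqP; split => [[x y]|[x y] []].
have [i1 e1] := integral_marginal measurable_fst g1 (integrable_dotv u mu2).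
have [i2 e2] := integral_marginal measurable_snd g2 (integrable_dotv u nu2).
set c := (\int[g]_z _)%E.
(* Infinite cost is trivial; finite cost makes the squared distance integrable, so that integrals
   can be split. *)
have [->|c_oo] := eqVneq c +oo%E; first exact: leey.
have mc : measurable_fun setT (fun z : 'rV[R]_d * 'rV[R]_d => (enorm (z.1 - z.2) ^+ 2)%:E).
  apply/measurable_EFinP/measurable_enorm_sqr/measurable_fun_row => i.
  under eq_fun do rewrite !mxE.
  by apply: measurable_funB; apply: (measurableT_comp (measurable_coord i)).
have ic : g.-integrable setT (fun z => (enorm (z.1 - z.2) ^+ 2)%:E).
  apply/integrableP; split => //.
  under eq_integral do rewrite gee0_abs ?lee_fin ?sqr_ge0//.
  by rewrite -/c ltey.
pose h (z : 'rV[R]_d * 'rV[R]_d) := (2%:E * ((dotv u z.1)%:E - (dotv u z.2)%:E))%E.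
pose k (z : 'rV[R]_d * 'rV[R]_d) := ((enorm u ^+ 2)%:E + (enorm (z.1 - z.2) ^+ 2)%:E)%E.
have iB : g.-integrable setT
    (fun z : 'rV[R]_d * 'rV[R]_d => (dotv u z.1)%:E - (dotv u z.2)%:E)%E.
  exact: integrableB.
have ih : g.-integrable setT h by exact: integrableZl.
have iu : g.-integrable setT (fun=> (enorm u ^+ 2)%:E).
  exact: finite_measure_integrable_cst.
have ik : g.-integrable setT k by exact: integrableD.
(* 2 u.(x - y) <= |u|^2 + |x - y|^2, where u.(x - y) has expectation |u|^2. *)
have : (\int[g]_z h z <= \int[g]_z k z)%E.
  apply: le_integral => // -[x y] _.
  by rewrite /h /k /= -EFinB -EFinM -EFinD lee_fin -dotvBr dotv_young.
rewrite integralD// integralZl// integralB// e1 e2 !integral_dotv_mean//.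
have -> : (\int[g]__ (enorm u ^+ 2)%:E = (enorm u ^+ 2)%:E)%E.
  by rewrite integral_cst// [X in (_ * X)%E]probability_setT mule1.
rewrite -EFinB -dotvBr -/u -/c enorm_sqr.
have : c \is a fin_num.
  by rewrite ge0_fin_numE ?ltey// integral_ge0// => z _; rewrite lee_fin sqr_ge0.
by move=> /fineK <-; rewrite -EFinM -EFinD !lee_fin; lra.
Qed.

Lemma W2_ge_mean mu nu :
  finite_second_moment mu -> finite_second_moment nu ->
  ((enorm (mean mu - mean nu))%:E <= W2 mu nu)%E.
Proof.
move=> mu2 nu2; rewrite -[leLHS]gee0_abs ?lee_fin ?enorm_ge0// -sqrte_sqr.
have le_inf : ((enorm (mean mu - mean nu) ^+ 2)%:E <= ereal_inf
    [set (\int[g]_z (enorm (z.1 - z.2) ^+ 2)%:E)%E | g in is_coupling mu nu])%E.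
  by apply: le_ereal_inf_tmp => _ [g gc <-]; exact: mean_le_coupling.
by rewrite lee_sqrt// (le_trans _ le_inf)// lee_fin sqr_ge0.
Qed.

(** The coupling is the law of (X, X + m' - m), whose cost is the constant |m - m'|^2. The form of
    the assumption on [nu] is that of the fixed-point equation. *)
Lemma W2_gaussian_le m m' v nu : 0 < v ->
  (forall A, measurable A -> nu A = gaussian m' v A) ->
  (W2 (gaussian m v) nu <= (enorm (m - m'))%:E)%E.
Proof.
move=> v0 nuE; pose a := m' - m.
pose phi (x : 'rV[R]_d) := (x, x + a).
have ma : measurable_fun setT (fun x : 'rV[R]_d => x + a).
  apply: measurable_fun_row => i; under eq_fun do rewrite !mxE.
  by apply: measurable_funD => //; exact: measurable_coord.
have mphi : measurable_fun setT phi by exact: measurable_fun_pair.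
pose phi_ : {mfun 'rV[R]_d >-> ('rV[R]_d * 'rV[R]_d)%type} :=
  HB.pack phi (isMeasurableFun.Build _ _ _ _ _ mphi).
pose g : probability ('rV[R]_d * 'rV[R]_d)%type R :=
  distribution (gaussian m v : probability _ _) phi_.
have gc : is_coupling (gaussian m v) nu g.
  move=> A mA; split; rewrite /g /= /distribution /pushforward.
    by congr (gaussian m v _); apply/seteqP; split => x //= [].
  rewrite nuE// (_ : m' = m + a); last by rewrite /a subrKC.
  rewrite -gaussian_shift//.
  by congr (gaussian m v _); apply/seteqP; split => x //= [].
rewrite -[leRHS]gee0_abs ?lee_fin ?enorm_ge0// -sqrte_sqr lee_sqrt//; last first.
  by rewrite lee_fin sqr_ge0.
apply: ge_ereal_inf; exists (\int[g]_z (enorm (z.1 - z.2) ^+ 2)%:E)%E.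
  by exists g.
rewrite ge0_integral_pushforward//; last 2 first.
- apply/measurable_EFinP/measurable_enorm_sqr/measurable_fun_row => i.
  under eq_fun do rewrite !mxE.
  by apply: measurable_funB; apply: (measurableT_comp (measurable_coord i)).
- by move=> z _; rewrite lee_fin sqr_ge0.
rewrite (eq_integral (cst (enorm (m - m') ^+ 2)%:E)); last first.
  move=> x _ /=; rewrite -[in RHS]enormN opprB -/a -[in RHS]enormN.
  by rewrite opprD addrA subrr sub0r.
by rewrite preimage_setT integral_cst// [X in (_ * X)%E]probability_setT mule1.
Qed.

End means_and_couplings.

(** * Means under the Bernoulli update *)

Section bernoulli_mean.
Context {R : realType} {n : nat}.

Lemma integral_tnth_bernoulli_tuple (r : 'I_n -> R) i :
  (forall i, 0 <= r i <= 1) ->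
  (\int[bernoulli_tuple r]_z ((tnth z i)%:R)%:E = (r i)%:E)%E.
Proof.
move=> r01.
(* The i-th coordinate is written as a product over all coordinates with trivial factors elsewhere,
   to fit the product integral formula. *)
pose f (j : 'I_n) (b : bool) : R := if j == i then b%:R else 1.
have -> : (\int[bernoulli_tuple r]_z ((tnth z i)%:R)%:E =
    \int[bernoulli_tuple r]_z (\prod_(j < n) f j (tnth z j))%:E)%E.
  apply: eq_integral => z _; congr EFin.
  rewrite (bigD1 i)//= /f eqxx big1 ?mulr1// => j /negbTE -> //.
rewrite ge0_integral_tuple_prod//; last by move=> j b; rewrite /f; case: ifP.
rewrite (bigD1 i)//= big1 => [|j /negbTE ji].
  by rewrite mule1 /f eqxx integral_bernoulli_prob// mule1 mule0 adde0.
rewrite integral_bernoulli_prob// => [|b]; rewrite /f ji ?lee_fin//.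
by rewrite !mule1 -EFinD subrKC.
Qed.

Lemma expectation_sign_bernoulli_tuple (r : 'I_n -> R) i :
  (forall i, 0 <= r i <= 1) ->
  ('E_(bernoulli_tuple r)[(fun z => 2 * (tnth z i)%:R - 1)%R] = (2 * r i - 1)%:E)%E.
Proof.
move=> r01; rewrite unlock; set P : probability _ _ := bernoulli_tuple r.
have mi : measurable_fun setT (fun z : n.-tuple bool => (tnth z i)%:R : R).
  apply: (measurableT_comp (f := fun b : bool => b%:R : R)) => //.
  exact: measurable_tnth.
have Pi := integral_tnth_bernoulli_tuple i r01.
have ii : P.-integrable setT (fun z => ((tnth z i)%:R)%:E).
  apply/integrableP; split; first exact/measurable_EFinP.
  under eq_integral do rewrite gee0_abs ?lee_fin ?ler0n//.
  by rewrite Pi ltry.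
transitivity (\int[P]_z (2%:E * ((tnth z i)%:R)%:E - 1%:E))%E.
  by apply: eq_integral => z _; rewrite EFinB EFinM.
rewrite integralB//; last 2 first.
- exact: integrableZl.
- exact: finite_measure_integrable_cst.
rewrite integralZl// [X in (_ * X)%E]Pi integral_cst//.
by rewrite [X in (_ - _ * X)%E]probability_setT mule1.
Qed.

(** Links the algorithm to the deterministic map: a sweep sees the current law only through its
    mean. *)
Lemma beta_mean_z_update d (y : 'I_n -> 'rV[R]_d) (p tau tau0 : R) mu :
  beta_mean y tau tau0 (z_update y p tau mu) = mean_map y p tau tau0 (mean mu).
Proof.
rewrite /beta_mean /mean_map; congr (_ *: _); apply: eq_bigr => i _.
rewrite expectation_sign_bernoulli_tuple// => j.
by case/andP: (expit_itv (ln (p / (1 - p)) + 2 * tau * dotv (y j) (mean mu)))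
  => /ltW -> /ltW ->.
Qed.

End bernoulli_mean.

(** * One-step contraction and induction along the iterates *)

Theorem proposition12 (R : realType) (d n : nat)
    (y : 'I_n -> 'rV[R]_d) (p tau tau0 : R)
    (hp : 0 < p < 1) (htau : 0 < tau) (htau0 : 0 < tau0)
    (mu_star : probability 'rV[R]_d R)
    (hfix : forall A, measurable A ->
       mu_star A = beta_update y tau tau0 (z_update y p tau mu_star) A)
    (eps : R) (heps : 0 < eps)
    (mu0 : probability 'rV[R]_d R) (hmu0 : P2 mu0)
    (hclose : (W2 mu0 mu_star < eps%:E)%E)
    (hrate : cavi_rate y p tau tau0 (mean mu_star) eps < 1) :
  forall k : nat,
    (W2 (cavi_beta y p tau tau0 mu0 k.+1) mu_star <=
     (cavi_rate y p tau tau0 (mean mu_star) eps)%:E *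
       W2 (cavi_beta y p tau tau0 mu0 k) mu_star)%E.
Proof.
have v0 : 0 < (tau0 + n%:R * tau)^-1 by rewrite invr_gt0 precision_gt0.
set r := cavi_rate _ _ _ _ _ _ in hrate *.
have r0 : 0 <= r by apply: cavi_rate_ge0 => //; exact: ltW.
have star2 : finite_second_moment mu_star.
  apply: (@eq_finite_second_moment _ _
    (beta_update y tau tau0 (z_update y p tau mu_star))).
    by move=> A mA; rewrite hfix.
  exact: gaussian_finite_second_moment.
have meanF mu : mean (beta_update y tau tau0 (z_update y p tau mu)) =
    mean_map y p tau tau0 (mean mu).
  by rewrite mean_gaussian// beta_mean_z_update.
have star_fix : mean_map y p tau tau0 (mean mu_star) = mean mu_star.
  by rewrite -meanF; apply/esym/eq_mean.
have mu2 k : finite_second_moment (cavi_beta y p tau tau0 mu0 k).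
  by case: k => [|k]; [exact: hmu0.2|exact: gaussian_finite_second_moment].
(* Contraction is available only inside the ball, so the step is first proved under that condition,
   which the W2 bound implies for the means. *)
have step k : (W2 (cavi_beta y p tau tau0 mu0 k) mu_star < eps%:E)%E ->
    (W2 (cavi_beta y p tau tau0 mu0 k.+1) mu_star <=
      r%:E * W2 (cavi_beta y p tau tau0 mu0 k) mu_star)%E.
  set mu := cavi_beta _ _ _ _ _ k => lt_eps.
  have le_mean : ((enorm (mean mu - mean mu_star))%:E <= W2 mu mu_star)%E.
    exact: (W2_ge_mean (mu2 k) star2).
  apply: (le_trans (W2_gaussian_le _ v0 hfix)); rewrite !beta_mean_z_update.
  apply: (@le_trans _ _ (r * enorm (mean mu - mean mu_star))%:E).
    rewrite lee_fin; apply: mean_map_contraction => //.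
    by rewrite -lee_fin; exact/ltW/(le_lt_trans le_mean).
  by rewrite EFinM lee_wpmul2l ?lee_fin.
(* Since r < 1, a step never increases W2, so the strict initial bound persists. *)
have in_ball k : (W2 (cavi_beta y p tau tau0 mu0 k) mu_star < eps%:E)%E.
  elim: k => [//|k IHk]; apply: le_lt_trans (IHk).
  apply: le_trans (step _ IHk) _.
  by rewrite -[leRHS]mul1e lee_wpmul2r ?sqrte_ge0// lee_fin ltW.
by move=> k; exact: step.
Qed.
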